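(* Let $\boldsymbol{P}_{i,j,k}\in\mathbb{R}^3$ ($i,j,k\in\mathbb{Z}_{\ge 0}$, $i+j+k=2$) be points such that $\boldsymbol{P}_{0,0,2},\boldsymbol{P}_{1,0,1},\boldsymbol{P}_{2,0,0}$ are non-collinear and lie in a plane $\Pi$, and such that the remaining points $\boldsymbol{P}_{0,1,1},\boldsymbol{P}_{1,1,0},\boldsymbol{P}_{0,2,0}$ all lie in the same open half-space determined by $\Pi$. Let $\boldsymbol{p}$ be the quadratic triangular Bézier patch with control points $\boldsymbol{P}_{i,j,k}$, and let $\boldsymbol{q}$ be the quadratic triangular Bézier patch with control points $\boldsymbol{Q}_{i,j,k}=\mathcal{R}_{\Pi}(\boldsymbol{P}_{i,j,k})$, where $\mathcal{R}_\Pi$ is the reflection in the plane $\Pi$. Put $$u_0=\boldsymbol{P}_{1,0,1}-\boldsymbol{P}_{0,0,2},\quad u_1=\boldsymbol{P}_{2,0,0}-\boldsymbol{P}_{1,0,1},\quad v_{00}=\boldsymbol{P}_{0,1,1}-\boldsymbol{P}_{0,0,2},\quad v_{10}=\boldsymbol{P}_{1,1,0}-\boldsymbol{P}_{1,0,1}.$$ Then the following conditions are equivalent: 1. The spline formed by $\boldsymbol{p}$ and $\boldsymbol{q}$ is $G^1$ continuous (along the common boundary curve $\eta=0$). 2. There exists $\alpha\in\mathbb{R}$ such that $\mathcal{P}_\Pi(v_{00})=\alpha u_0$ and $\mathcal{P}_\Pi(v_{10})=\alpha u_1$. 3. The spline formed by $\boldsymbol{p}$ and $\boldsymbol{q}$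 is $G^2$ continuous (along the common boundary curve $\eta=0$). 4. For every $\xi\in[0,1]$, the vector $\frac{\partial}{\partial\xi}\boldsymbol{p}(\xi,0)\times(u_0\times u_1)$ is a normal vector to the tangent plane of $\boldsymbol{p}$ at $\boldsymbol{p}(\xi,0)$.
   Context: Let $\Delta=\{(\xi,\eta)\in\mathbb{R}^2: \xi,\eta\ge 0,\ \xi+\eta\le 1\}$. The quadratic triangular Bézier patch with control points $\boldsymbol{P}_{i,j,k}\in\mathbb{R}^3$, $i+j+k=2$, is the map $\boldsymbol{p}:\Delta\to\mathbb{R}^3$, $$\boldsymbol{p}(\xi,\eta)=\sum_{i+j+k=2}\frac{2}{i!\,j!\,k!}\,\xi^i\eta^j(1-\xi-\eta)^k\,\boldsymbol{P}_{i,j,k}.$$ $\mathcal{P}_\Pi$, applied to a vector, denotes the orthogonal projection onto the linear plane parallel to $\Pi$, i.e. onto $\mathrm{span}(u_0,u_1)$. Two patches $\boldsymbol{p},\boldsymbol{q}$ with $\boldsymbol{p}(\xi,0)=\boldsymbol{q}(\xi,0)$ for all $\xi\in[0,1]$ form a $G^1$ continuous spline if for every $\xi\in[0,1]$ the vectors $\frac{\partial\boldsymbol{p}}{\partial\xi}(\xi,0)=\frac{\partial\boldsymbol{q}}{\partial\xi}(\xi,0)$, $\frac{\partial\boldsymbol{p}}{\partial\eta}(\xi,0)$, $\frac{\partial\boldsymbol{q}}{\partial\eta}(\xi,0)$ are coplanar (linearly dependent), i.e. the tangent planes coincide along the common boundary curve. They form a $G^2$ continuous spline if there are real functions $s_1,t_1,s_2,t_2$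 on $[0,1]$ such that for all $\xi\in[0,1]$ $$\tfrac{\partial\boldsymbol{q}}{\partial\eta}=s_1\tfrac{\partial\boldsymbol{p}}{\partial\eta}+t_1\tfrac{\partial\boldsymbol{p}}{\partial\xi},\qquad \tfrac{\partial^2\boldsymbol{q}}{\partial\eta^2}=s_1^2\tfrac{\partial^2\boldsymbol{p}}{\partial\eta^2}+2s_1t_1\tfrac{\partial^2\boldsymbol{p}}{\partial\xi\partial\eta}+t_1^2\tfrac{\partial^2\boldsymbol{p}}{\partial\xi^2}+s_2\tfrac{\partial\boldsymbol{p}}{\partial\eta}+t_2\tfrac{\partial\boldsymbol{p}}{\partial\xi},$$ where all derivatives are evaluated at $(\xi,0)$ and $s_i,t_i$ at $\xi$. The tangent plane of $\boldsymbol{p}$ at $\boldsymbol{p}(\xi,0)$ is the plane spanned by $\frac{\partial\boldsymbol{p}}{\partial\xi}(\xi,0)$ and $\frac{\partial\boldsymbol{p}}{\partial\eta}(\xi,0)$; normal vectors are understood up to a nonzero scalar factor. *)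

(* Defs.v *)
From HB Require Import structures.
From mathcomp Require Export all_boot all_order all_algebra.
From mathcomp Require Export all_classical all_reals all_analysis.

Set Implicit Arguments.
Unset Strict Implicit.
Unset Printing Implicit Defensive.

Import Order.TTheory GRing.Theory Num.Theory.
Import numFieldNormedType.Exports.
Local Open Scope classical_set_scope.
Local Open Scope ring_scope.

Definition dot (R : realType) (u v : 'rV[R]_3) : R :=
  \sum_(i < 3) u 0 i * v 0 i.

(* The additions [i + 1] and [i + 2] are those of 'I_3, i.e. modulo 3. *)
Definition cross (R : realType) (u v : 'rV[R]_3) : 'rV[R]_3 :=
  \row_(i < 3) (u 0 (i + 1) * v 0 (i + 2) - u 0 (i + 2) * v 0 (i + 1)).

Definition collinear (R : realType) (A B C : 'rV[R]_3) : Prop :=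
  exists a d : 'rV[R]_3, d != 0 /\
    forall X, X \in [:: A; B; C] -> exists t : R, X = a + t *: d.

(* The affine plane of all X with [dot (normal Pi) X = offset Pi]. *)
Record plane (R : realType) := Plane {
  normal : 'rV[R]_3;
  offset : R;
  normal_neq0 : normal != 0
}.

Definition height (R : realType) (Pi : plane R) (X : 'rV[R]_3) : R :=
  dot (normal Pi) X - offset Pi.

Definition on_plane (R : realType) (Pi : plane R) (X : 'rV[R]_3) : Prop :=
  height Pi X = 0.

Definition same_open_half_space (R : realType) (Pi : plane R)
    (s : seq 'rV[R]_3) : Prop :=
  (forall X, X \in s -> 0 < height Pi X) \/
  (forall X, X \in s -> height Pi X < 0).

Definition reflection (R : realType) (Pi : plane R) (X : 'rV[R]_3) : 'rV[R]_3 :=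
  X - (2 * height Pi X / dot (normal Pi) (normal Pi)) *: normal Pi.

(* Projection of vectors (not of points): the offset of the plane plays no
   role, the image is the linear plane parallel to Pi. *)
Definition vproj (R : realType) (Pi : plane R) (v : 'rV[R]_3) : 'rV[R]_3 :=
  v - (dot (normal Pi) v / dot (normal Pi) (normal Pi)) *: normal Pi.

(* Only the control points [P i j k] with i + j + k = 2 are used.  The
   polynomial map is defined on the whole of R^2 rather than on the triangle,
   so that partial derivatives at boundary points of the triangle are the
   ordinary two-sided ones. *)
Definition bezier2 (R : realType) (P : nat -> nat -> nat -> 'rV[R]_3)
    (xi eta : R) : 'rV[R]_3 :=
  \sum_(i < 3) \sum_(j < 3) \sum_(k < 3 | (i + j + k)%N == 2%N)
    (2 / (i`! * j`! * k`!)%:R * xi ^+ i * eta ^+ j * (1 - xi - eta) ^+ k)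
      *: P i j k.

Definition d_xi (R : realType) (f : R -> R -> 'rV[R]_3) : R -> R -> 'rV[R]_3 :=
  fun xi eta => derive1 (fun x : R => f x eta) xi.

Definition d_eta (R : realType) (f : R -> R -> 'rV[R]_3) : R -> R -> 'rV[R]_3 :=
  fun xi eta => derive1 (fun y : R => f xi y) eta.

Definition common_boundary (R : realType) (p q : R -> R -> 'rV[R]_3) : Prop :=
  forall xi : R, 0 <= xi <= 1 -> p xi 0 = q xi 0.

Definition G1_spline (R : realType) (p q : R -> R -> 'rV[R]_3) : Prop :=
  common_boundary p q /\
  forall xi : R, 0 <= xi <= 1 ->
    ~~ free [:: d_xi p xi 0; d_eta p xi 0; d_eta q xi 0].

Definition G2_spline (R : realType) (p q : R -> R -> 'rV[R]_3) : Prop :=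
  common_boundary p q /\
  exists s1 t1 s2 t2 : R -> R, forall xi : R, 0 <= xi <= 1 ->
    d_eta q xi 0 = s1 xi *: d_eta p xi 0 + t1 xi *: d_xi p xi 0 /\
    d_eta (d_eta q) xi 0 =
      s1 xi ^+ 2 *: d_eta (d_eta p) xi 0
      + (2 * s1 xi * t1 xi) *: d_xi (d_eta p) xi 0
      + t1 xi ^+ 2 *: d_xi (d_xi p) xi 0
      + s2 xi *: d_eta p xi 0 + t2 xi *: d_xi p xi 0.

Definition tangent_plane (R : realType) (p : R -> R -> 'rV[R]_3) (xi : R) :
    {vspace 'rV[R]_3} :=
  <<[:: d_xi p xi 0; d_eta p xi 0]>>%VS.

(* The condition on the dimension makes U a genuine plane, so that a normal
   vector is unique up to a nonzero scalar factor. *)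
Definition normal_vector (R : realType) (U : {vspace 'rV[R]_3})
    (N : 'rV[R]_3) : Prop :=
  [/\ \dim U = 2%N, N != 0 & forall v, v \in U -> dot N v = 0].

(* Main.v *)
(* Write U and V for half the partial derivatives of p along the boundary curve;
   they are the affine interpolations, with parameter xi, of u0, u1 and of
   v00, v10, and half the eta-derivative of q is V - 2 m n, where n is normal to
   Pi.  Since P011 and P110 lie strictly on the same side of Pi, m never
   vanishes on [0, 1], so that both G1 continuity and condition 4 amount to
   n . (U x V) = 0.  The values of this quadratic polynomial at 0, 1/2 and 1
   give the common factor alpha.  Conversely V = alpha U + m n, which yields
   condition 4, and the G2 equations hold with s1 = -1, t1 = 2 alpha,
   t2 = - alpha s2, where s2 is determined by the n-component. *)
From mathcomp Require Import ring lra.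
Require Import Defs.
Set Implicit Arguments.
Unset Strict Implicit.
Unset Printing Implicit Defensive.
Import Order.TTheory GRing.Theory Num.Theory.
Import numFieldNormedType.Exports.
Local Open Scope classical_set_scope.
Local Open Scope ring_scope.

(** * Coordinates and vector identities in three-space *)

Lemma row3P (R : realType) (u v : 'rV[R]_3) :
  u 0 0 = v 0 0 -> u 0 1 = v 0 1 -> u 0 2 = v 0 2 -> u = v.
Proof.
move=> e0 e1 e2; apply/rowP => -[[|[|[|//]]]] lt_i.
- by rewrite (_ : Ordinal lt_i = 0) //; apply: val_inj.
- by rewrite (_ : Ordinal lt_i = 1) //; apply: val_inj.
- by rewrite (_ : Ordinal lt_i = 2) //; apply: val_inj.
Qed.

Lemma dotE (R : realType) (u v : 'rV[R]_3) :
  dot u v = u 0 0 * v 0 0 + u 0 1 * v 0 1 + u 0 2 * v 0 2.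
Proof.
rewrite /dot !big_ord_recl big_ord0 addr0 addrA.
by congr (_ * _ + _ * _ + _ * _); congr (_ _ _); apply: val_inj.
Qed.

Lemma crossE (R : realType) (u v : 'rV[R]_3) :
  (cross u v 0 0 = u 0 1 * v 0 2 - u 0 2 * v 0 1) *
  (cross u v 0 1 = u 0 2 * v 0 0 - u 0 0 * v 0 2) *
  (cross u v 0 2 = u 0 0 * v 0 1 - u 0 1 * v 0 0).
Proof.
by rewrite !mxE; split; [split|]; congr (_ * _ - _ * _); congr (_ _ _);
  apply: val_inj.
Qed.

Lemma row3D (R : realType) (u v : 'rV[R]_3) i : (u + v) 0 i = u 0 i + v 0 i.
Proof. by rewrite mxE. Qed.

Lemma row3N (R : realType) (u : 'rV[R]_3) i : (- u) 0 i = - u 0 i.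
Proof. by rewrite mxE. Qed.

Lemma row3Z (R : realType) (a : R) (u : 'rV[R]_3) i : (a *: u) 0 i = a * u 0 i.
Proof. by rewrite mxE. Qed.

Lemma row30 (R : realType) (i : 'I_3) : (0 : 'rV[R]_3) 0 i = 0.
Proof. by rewrite mxE. Qed.

(* [mxE] would also unfold [cross], leaving indices such as [1 + 2 : 'I_3]. *)
Definition coordE := (dotE, row3D, row3N, row3Z, row30, crossE).

Lemma cross_cross (R : realType) (a b c : 'rV[R]_3) :
  cross a (cross b c) = dot a c *: b - dot a b *: c.
Proof. by apply: row3P; rewrite !coordE; ring. Qed.

Lemma dot0r (R : realType) (u : 'rV[R]_3) : dot u 0 = 0.
Proof. by rewrite !coordE; ring. Qed.

Lemma cross0r (R : realType) (u : 'rV[R]_3) : cross u 0 = 0.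
Proof. by apply: row3P; rewrite !coordE; ring. Qed.

Lemma cross0l (R : realType) (u : 'rV[R]_3) : cross 0 u = 0.
Proof. by apply: row3P; rewrite !coordE; ring. Qed.

Lemma dotB (R : realType) (n u v : 'rV[R]_3) :
  dot n (u - v) = dot n u - dot n v.
Proof. by rewrite !coordE; ring. Qed.

Lemma dotC (R : realType) (u v : 'rV[R]_3) : dot u v = dot v u.
Proof. by rewrite !coordE; ring. Qed.

(** * Vanishing products, linear dependence and normal vectors *)

Lemma dotvv_eq0 (R : realType) (v : 'rV[R]_3) : (dot v v == 0) = (v == 0).
Proof.
apply/eqP/eqP => [|->]; last exact: dot0r.
rewrite dotE -!expr2 => /eqP.
rewrite !paddr_eq0 ?addr_ge0 ?sqr_ge0 // !sqrf_eq0 -andbA.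
move=> /and3P[/eqP ? /eqP ? /eqP ?].
by apply: row3P; rewrite row30.
Qed.

(** The expansion of u x (u x v) is (u.v) u - (u.u) v, and here it vanishes. *)
Lemma cross_eq0_parallel (R : realType) (u v : 'rV[R]_3) :
  u != 0 -> cross u v = 0 -> v = (dot u v / dot u u) *: u.
Proof.
rewrite -dotvv_eq0 => u0 uv0.
have := cross_cross u u v; rewrite uv0 cross0r => /esym/subr0_eq e.
by rewrite mulrC -scalerA e scalerA mulVf ?scale1r.
Qed.

Lemma not_free2_cross (R : realType) (a b : 'rV[R]_3) :
  ~~ free [:: a; b] -> cross a b = 0.
Proof.
rewrite free_cons negb_and negbK span_seq1 => /orP[/vlineP[k ->]|].
  by apply: row3P; rewrite !coordE; ring.
by rewrite seq1_free negbK => /eqP ->; rewrite cross0r.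
Qed.

Lemma span2P (R : realType) (a b v : 'rV[R]_3) :
  reflect (exists s t, v = s *: a + t *: b) (v \in <<[:: a; b]>>%VS).
Proof.
rewrite span_cons span_seq1; apply: (iffP memv_addP).
  by move=> [_ /vlineP[s ->] [_ /vlineP[t ->] ->]]; exists s, t.
move=> [s [t ->]]; exists (s *: a); first exact: memvZ (memv_line _).
by exists (t *: b) => //; exact: memvZ (memv_line _).
Qed.

Lemma not_free3_dot (R : realType) (a b c : 'rV[R]_3) :
  ~~ free [:: a; b; c] -> dot (cross a b) c = 0.
Proof.
rewrite free_cons negb_and negbK => /orP[/span2P[s [t ->]]|].
  by rewrite !coordE; ring.
move=> /not_free2_cross bc0; have -> : dot (cross a b) c = dot a (cross b c).
  by rewrite !coordE; ring.
by rewrite bc0 dot0r.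
Qed.

(** By contraposition: if the product vanishes, the line through A directed by B - A contains C.
    When B = A, the direction C - A serves instead. *)
Lemma cross_sub_neq0 (R : realType) (A B C : 'rV[R]_3) :
  ~ collinear A B C -> cross (B - A) (C - B) != 0.
Proof.
move=> ncol; apply/eqP => uv0; apply: ncol; exists A.
have [u0|u0] := eqVneq (B - A) 0; last first.
  exists (B - A); split=> // X; rewrite !inE => /or3P[] /eqP ->.
  - by exists 0; rewrite scale0r addr0.
  - by exists 1; rewrite scale1r addrC subrK.
  - exists (1 + dot (B - A) (C - B) / dot (B - A) (B - A)).
    rewrite scalerDl scale1r -cross_eq0_parallel //.
    by apply: row3P; rewrite !coordE; ring.
have -> : B = A by apply/eqP; rewrite -subr_eq0 u0.
have [d [d0 [t Ct]]] : exists d : 'rV[R]_3, d != 0 /\ exists t, C - A = t *: d.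
  have [e|e] := eqVneq (C - A) 0.
    (* All three points coincide, so any nonzero direction will do. *)
    exists (\row_(i < 3) 1); split; last by exists 0; rewrite e scale0r.
    by apply/eqP => /rowP/(_ 0)/eqP; rewrite !mxE oner_eq0.
  by exists (C - A); split=> //; exists 1; rewrite scale1r.
exists d; split=> // X; rewrite !inE => /or3P[] /eqP ->.
- by exists 0; rewrite scale0r addr0.
- by exists 0; rewrite scale0r addr0.
- by exists t; rewrite -Ct addrC subrK.
Qed.

(** Since w is parallel to n, it is orthogonal to d, and d x w is orthogonal to both d and n, which
    span the plane. It serves with d the xi-derivative and w = u0 x u1. *)
Lemma normal_vector_cross (R : realType) (n w d : 'rV[R]_3) (a k : R) :
  d != 0 -> k != 0 -> n != 0 -> w != 0 -> dot n d = 0 -> cross n w = 0 ->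
  normal_vector <<[:: d; (a *: d + k *: n)%R]>>%VS (cross d w).
Proof.
move=> d0 k0 n0 w0 nd nw.
have wd : dot w d = 0.
  have := cross_cross d n w; rewrite nw cross0r (dotC d n) nd scale0r subr0.
  by move=> /esym/eqP; rewrite scaler_eq0 (negPf n0) orbF dotC => /eqP.
split.
(* Freeness of a pair is by definition the equality of the dimension of its span with 2. *)
- suff /eqP : free [:: d; a *: d + k *: n] by [].
  apply: contraT => /not_free2_cross dkn.
  have dn : cross d n = 0.
    apply/eqP; have : k *: cross d n = 0.
      by rewrite -dkn; apply: row3P; rewrite !coordE; ring.
    by move=> /eqP; rewrite scaler_eq0 (negPf k0).
  have /esym/eqP := cross_cross d d n.
  rewrite dn cross0r dotC nd scale0r sub0r.
  by rewrite oppr_eq0 scaler_eq0 dotvv_eq0 (negPf d0) (negPf n0).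
- apply/eqP => dw; have /esym/eqP := cross_cross w d w.
  rewrite dw cross0r wd scale0r subr0.
  by rewrite scaler_eq0 dotvv_eq0 (negPf w0) (negPf d0).
- move=> _ /span2P[s [t ->]].
  have -> : dot (cross d w) (s *: d + t *: (a *: d + k *: n)) =
    - (t * k) * dot d (cross n w) by rewrite !coordE; ring.
  by rewrite nw dot0r mulr0.
Qed.

(** * Interpolated vectors and their projections onto the plane *)

Definition lerp (R : realType) (A B : 'rV[R]_3) (x : R) : 'rV[R]_3 :=
  (1 - x) *: A + x *: B.

(** With L the interpolated vector, u0 x L and L x u1 are the multiples of u0 x u1 by x and 1 - x,
    so they add up to u0 x u1. This makes the boundary curve regular. *)
Lemma lerp_neq0 (R : realType) (u0 u1 : 'rV[R]_3) (x : R) :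
  cross u0 u1 != 0 -> lerp u0 u1 x != 0.
Proof.
apply: contraNneq => e.
have -> : cross u0 u1 = cross u0 (lerp u0 u1 x) + cross (lerp u0 u1 x) u1.
  by apply: row3P; rewrite /lerp !coordE; ring.
by rewrite e cross0l cross0r addr0.
Qed.

Lemma cross_orthogonal (R : realType) (n u v : 'rV[R]_3) :
  dot n u = 0 -> dot n v = 0 ->
  dot n n *: cross u v = dot n (cross u v) *: n.
Proof.
move=> nu nv; have := cross_cross n n (cross u v).
rewrite (cross_cross n u v) nu nv !scale0r subrr cross0r.
by move=> /esym/subr0_eq ->.
Qed.

(** Removing the n-component of v does not change n.(u x v). For the projection w, u x w is then
    parallel to n with no component along n, hence zero. *)
Lemma vproj_parallel (R : realType) (Pi : plane R) (u v : 'rV[R]_3) :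
  u != 0 -> dot (normal Pi) u = 0 -> dot (normal Pi) (cross u v) = 0 ->
  exists a, vproj Pi v = a *: u.
Proof.
move: (normal_neq0 Pi); rewrite /vproj -dotvv_eq0.
set n := normal Pi => n0 u0 nu nuv.
exists (dot u (v - (dot n v / dot n n) *: n) / dot u u).
apply: cross_eq0_parallel => //; set w := _ - _.
have nw : dot n w = 0.
  have -> : dot n w = dot n v - dot n v / dot n n * dot n n.
    by rewrite /w !coordE; ring.
  by rewrite divfK ?subrr.
have nuw : dot n (cross u w) = 0 by rewrite -nuv /w; rewrite !coordE; ring.
apply/eqP; have := cross_orthogonal nu nw; rewrite nuw scale0r => /eqP.
by rewrite scaler_eq0 (negPf n0).
Qed.

Lemma vproj_lerp (R : realType) (Pi : plane R) (u0 u1 v0 v1 : 'rV[R]_3) :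
  dot (normal Pi) u0 = 0 -> dot (normal Pi) u1 = 0 -> cross u0 u1 != 0 ->
  (forall x, 0 <= x <= 1 ->
    dot (normal Pi) (cross (lerp u0 u1 x) (lerp v0 v1 x)) = 0) ->
  exists a, vproj Pi v0 = a *: u0 /\ vproj Pi v1 = a *: u1.
Proof.
move=> nu0 nu1 u01 nuv.
have u0N0 : u0 != 0 by apply: contraNneq u01 => ->; rewrite cross0l.
have u1N0 : u1 != 0 by apply: contraNneq u01 => ->; rewrite cross0r.
have nuv0 : dot (normal Pi) (cross u0 v0) = 0.
  by rewrite -(nuv 0) ?lexx ?ler01 // /lerp subr0 !scale1r !scale0r !addr0.
have nuv1 : dot (normal Pi) (cross u1 v1) = 0.
  by rewrite -(nuv 1) ?lexx ?ler01 // /lerp subrr !scale1r !scale0r !add0r.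
have [a va] := vproj_parallel u0N0 nu0 nuv0.
have [b vb] := vproj_parallel u1N0 nu1 nuv1.
exists a; split=> //; suff -> : a = b by [].
(* The endpoints gave separate factors a and b. The value at 1/2 isolates the mixed terms, which
   amount to (b - a) n.(u0 x u1). *)
have nuv2 : dot (normal Pi) (cross u0 v1) + dot (normal Pi) (cross u1 v0) = 0.
  have h : 0 <= (2^-1 : R) <= 1 by lra.
  have := nuv _ h.
  have -> : dot (normal Pi) (cross (lerp u0 u1 2^-1) (lerp v0 v1 2^-1)) =
    (dot (normal Pi) (cross u0 v0) + (dot (normal Pi) (cross u0 v1)
      + dot (normal Pi) (cross u1 v0)) + dot (normal Pi) (cross u1 v1)) / 4.
    by rewrite /lerp !coordE; field.
  by rewrite nuv0 nuv1 add0r addr0; lra.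
move: nuv2; have nvproj u v :
    dot (normal Pi) (cross u v) = dot (normal Pi) (cross u (vproj Pi v)).
  by rewrite /vproj !coordE; ring.
rewrite (nvproj u0) (nvproj u1) va vb.
have -> : dot (normal Pi) (cross u0 (b *: u1))
    + dot (normal Pi) (cross u1 (a *: u0)) =
  (b - a) * dot (normal Pi) (cross u0 u1) by rewrite !coordE; ring.
move=> /eqP; rewrite mulf_eq0 subr_eq0 => /orP[/eqP -> //|/eqP n01].
have := cross_orthogonal nu0 nu1; rewrite n01 scale0r => /eqP.
by rewrite scaler_eq0 (negPf u01) orbF dotvv_eq0 (negPf (normal_neq0 Pi)).
Qed.

(** * The quadratic patch and its derivatives along the boundary *)

Lemma bezier2E (R : realType) (P : nat -> nat -> nat -> 'rV[R]_3) (x y : R) :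
  bezier2 P x y =
    (1 - x - y) ^+ 2 *: (P 0 0 2)%N + (2 * x * (1 - x - y)) *: (P 1 0 1)%N
    + x ^+ 2 *: (P 2 0 0)%N + (2 * y * (1 - x - y)) *: (P 0 1 1)%N
    + (2 * x * y) *: (P 1 1 0)%N + y ^+ 2 *: (P 0 2 0)%N.
Proof.
rewrite /bezier2.
under eq_bigr do under eq_bigr do
  rewrite big_mkcond !big_ord_recl big_ord0 /=.
rewrite !big_ord_recl !big_ord0 /bump /= !addn0 !add1n !factS fact0.
by apply: row3P; rewrite !coordE; field.
Qed.

(** In each variable the patch has degree two, so this covers every partial derivative; the
    second-order ones take A = 0. *)
Lemma derive1_quadratic (R : realType) (A B C : 'rV[R]_3) (x : R) :
  derive1 (fun t => t ^+ 2 *: A + t *: B + C) x = (2 * x) *: A + B.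
Proof.
have D1 (k : R -> R) (V : 'rV[R]_3) (l : R) :
    is_derive x 1 k l -> is_derive x 1 (fun t => k t *: V) (l *: V).
  move=> [dk <-]; have dk' : differentiable k x by apply/derivable1_diffP.
  have ? := differentiableZl V dk'.
  apply: DeriveDef; first exact: diff_derivable.
  by rewrite deriveE // diffZl // deriveE.
rewrite derive1E.
have dA : is_derive x 1 (fun t : R => t ^+ 2 *: A) ((2 * x) *: A).
  by apply: D1; apply: is_derive_eq; rewrite /= scaler1 mulr_natl.
have dB : is_derive x 1 (fun t : R => t *: B) (1 *: B) by apply: D1.
have dC := is_derive_cst C x 1.
by have [_ ->] := is_deriveD (is_deriveD dA dB) dC; rewrite scale1r addr0.
Qed.

Lemma d_xi_bezier2 (R : realType)
    (P : nat -> nat -> nat -> 'rV[R]_3) (x : R) :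
  d_xi (bezier2 P) x 0 =
  2 *: lerp ((P 1 0 1)%N - (P 0 0 2)%N) ((P 2 0 0)%N - (P 1 0 1)%N) x.
Proof.
rewrite /d_xi (_ : (fun _ => _) = fun t =>
  t ^+ 2 *: ((P 2 0 0)%N - 2 *: (P 1 0 1)%N + (P 0 0 2)%N)
  + t *: (2 *: ((P 1 0 1)%N - (P 0 0 2)%N)) + (P 0 0 2)%N).
  by rewrite derive1_quadratic /lerp; apply: row3P; rewrite !coordE; ring.
apply/funext => t; rewrite bezier2E.
by apply: row3P; rewrite !coordE; ring.
Qed.

(** The formula is kept for all y because the second eta-derivative differentiates it in y. *)
Lemma d_eta_bezier2 (R : realType)
    (P : nat -> nat -> nat -> 'rV[R]_3) (x y : R) :
  d_eta (bezier2 P) x y =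
  2 *: lerp ((P 0 1 1)%N - (P 0 0 2)%N) ((P 1 1 0)%N - (P 1 0 1)%N) x
  + (2 * y) *: ((P 0 0 2)%N - 2 *: (P 0 1 1)%N + (P 0 2 0)%N).
Proof.
rewrite /d_eta (_ : (fun _ => _) = fun t =>
  t ^+ 2 *: ((P 0 0 2)%N - 2 *: (P 0 1 1)%N + (P 0 2 0)%N)
  + t *: (2 *: lerp ((P 0 1 1)%N - (P 0 0 2)%N) ((P 1 1 0)%N - (P 1 0 1)%N) x)
  + bezier2 P x 0).
  by rewrite derive1_quadratic addrC.
apply/funext => t; rewrite !bezier2E /lerp.
by apply: row3P; rewrite !coordE; ring.
Qed.

Lemma d_xi_xi_bezier2 (R : realType)
    (P : nat -> nat -> nat -> 'rV[R]_3) (x : R) :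
  d_xi (d_xi (bezier2 P)) x 0 =
  2 *: ((P 2 0 0)%N - 2 *: (P 1 0 1)%N + (P 0 0 2)%N).
Proof.
rewrite {1}/d_xi (_ : (fun _ => _) = fun t =>
  t ^+ 2 *: 0 + t *: (2 *: ((P 2 0 0)%N - 2 *: (P 1 0 1)%N + (P 0 0 2)%N))
  + 2 *: ((P 1 0 1)%N - (P 0 0 2)%N)).
  by rewrite derive1_quadratic scaler0 add0r.
apply/funext => t; rewrite d_xi_bezier2 /lerp.
by apply: row3P; rewrite !coordE; ring.
Qed.

Lemma d_xi_eta_bezier2 (R : realType)
    (P : nat -> nat -> nat -> 'rV[R]_3) (x : R) :
  d_xi (d_eta (bezier2 P)) x 0 =
  2 *: ((P 1 1 0)%N - (P 1 0 1)%N - ((P 0 1 1)%N - (P 0 0 2)%N)).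
Proof.
rewrite {1}/d_xi (_ : (fun _ => _) = fun t =>
  t ^+ 2 *: 0 + t *: (2 *: ((P 1 1 0)%N - (P 1 0 1)%N
                            - ((P 0 1 1)%N - (P 0 0 2)%N)))
  + 2 *: ((P 0 1 1)%N - (P 0 0 2)%N)).
  by rewrite derive1_quadratic scaler0 add0r.
apply/funext => t; rewrite d_eta_bezier2 /lerp.
by apply: row3P; rewrite !coordE; ring.
Qed.

Lemma d_eta_eta_bezier2 (R : realType)
    (P : nat -> nat -> nat -> 'rV[R]_3) (x y : R) :
  d_eta (d_eta (bezier2 P)) x y =
  2 *: ((P 0 0 2)%N - 2 *: (P 0 1 1)%N + (P 0 2 0)%N).
Proof.
rewrite {1}/d_eta (_ : (fun _ => _) = fun t =>
  t ^+ 2 *: 0 + t *: (2 *: ((P 0 0 2)%N - 2 *: (P 0 1 1)%N + (P 0 2 0)%N))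
  + 2 *: lerp ((P 0 1 1)%N - (P 0 0 2)%N) ((P 1 1 0)%N - (P 1 0 1)%N) x).
  by rewrite derive1_quadratic scaler0 add0r.
apply/funext => t; rewrite d_eta_bezier2 /lerp.
by apply: row3P; rewrite !coordE; ring.
Qed.

(** * Equivalence of the smoothness conditions for a patch and its mirror image *)

Theorem theorem2p1 (R : realType) (Pi : plane R)
    (P : nat -> nat -> nat -> 'rV[R]_3)
    (hcol : ~ collinear (P 0 0 2)%N (P 1 0 1)%N (P 2 0 0)%N)
    (h002 : on_plane Pi (P 0 0 2)%N)
    (h101 : on_plane Pi (P 1 0 1)%N)
    (h200 : on_plane Pi (P 2 0 0)%N)
    (hside : same_open_half_space Pi
               [:: (P 0 1 1)%N; (P 1 1 0)%N; (P 0 2 0)%N]) :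
  let p := bezier2 P in
  let q := bezier2 (fun i j k => reflection Pi (P i j k)) in
  let u0 := (P 1 0 1)%N - (P 0 0 2)%N in
  let u1 := (P 2 0 0)%N - (P 1 0 1)%N in
  let v00 := (P 0 1 1)%N - (P 0 0 2)%N in
  let v10 := (P 1 1 0)%N - (P 1 0 1)%N in
  [<-> G1_spline p q;
       exists alpha : R, vproj Pi v00 = alpha *: u0 /\ vproj Pi v10 = alpha *: u1;
       G2_spline p q;
       forall xi : R, 0 <= xi <= 1 ->
         normal_vector (tangent_plane p xi)
                       (cross (d_xi p xi 0) (cross u0 u1))].
Proof.
move=> p q u0 u1 v00 v10.
have u0E : u0 = (P 1 0 1)%N - (P 0 0 2)%N by [].
have u1E : u1 = (P 2 0 0)%N - (P 1 0 1)%N by [].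
have v00E : v00 = (P 0 1 1)%N - (P 0 0 2)%N by [].
have v10E : v10 = (P 1 1 0)%N - (P 1 0 1)%N by [].
set n := normal Pi; set N := dot n n.
(* [be A] is the signed height of A measured in units of n, so that reflection subtracts [2 * be A]
   times n. *)
pose be A := height Pi A / N.
have N0 : N != 0 by rewrite dotvv_eq0 normal_neq0.
have dotn A B : dot n (A - B) = height Pi A - height Pi B.
  by rewrite dotB /height; ring.
have nu0 : dot n u0 = 0 by rewrite u0E dotn h101 h002 subrr.
have nu1 : dot n u1 = 0 by rewrite u1E dotn h101 h200 subrr.
have u01 : cross u0 u1 != 0 := cross_sub_neq0 hcol.
clearbody u0 u1 v00 v10.
pose b0 := be (P 0 1 1)%N; pose b1 := be (P 1 1 0)%N; pose c := be (P 0 2 0)%N.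
(* [m x] is the coefficient along n of half the eta-derivative of p; it is a convex combination of
   two numbers of the same strict sign. *)
pose m x := (1 - x) * b0 + x * b1.
have mN0 x : 0 <= x <= 1 -> m x != 0.
  move=> /andP[x0 x1].
  have -> : m x = ((1 - x) * height Pi (P 0 1 1)%N
                   + x * height Pi (P 1 1 0)%N) / N.
    by rewrite /m /b0 /b1 /be; ring.
  rewrite mulf_neq0 ?invr_neq0 //.
  by case: hside => h; have := h (P 0 1 1)%N; have := h (P 1 1 0)%N;
    rewrite !inE !eqxx !orbT => /(_ isT) h1 /(_ isT) h0; apply/eqP; nra.
have reflE A : reflection Pi A = A - (2 * be A) *: n.
  by rewrite /reflection mulrA.
have Q002 : reflection Pi (P 0 0 2)%N = (P 0 0 2)%N.
  by rewrite reflE /be h002 mul0r mulr0 scale0r subr0.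
have Q101 : reflection Pi (P 1 0 1)%N = (P 1 0 1)%N.
  by rewrite reflE /be h101 mul0r mulr0 scale0r subr0.
have Q200 : reflection Pi (P 2 0 0)%N = (P 2 0 0)%N.
  by rewrite reflE /be h200 mul0r mulr0 scale0r subr0.
have pxi x : d_xi p x 0 = 2 *: lerp u0 u1 x by rewrite /p d_xi_bezier2 u0E u1E.
have peta x : d_eta p x 0 = 2 *: lerp v00 v10 x.
  by rewrite /p d_eta_bezier2 mulr0 scale0r addr0 v00E v10E.
have qeta x : d_eta q x 0 = 2 *: (lerp v00 v10 x - (2 * m x) *: n).
  rewrite /q d_eta_bezier2 mulr0 scale0r addr0 Q002 Q101 !reflE.
  by rewrite -/b0 -/b1 /m /lerp v00E v10E; apply: row3P; rewrite !coordE; ring.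
have bdry : common_boundary p q.
  move=> x _; rewrite /p /q !bezier2E Q002 Q101 Q200.
  by apply: row3P; rewrite !coordE; ring.
pose C2 := exists alpha : R,
  vproj Pi v00 = alpha *: u0 /\ vproj Pi v10 = alpha *: u1.
have vprojE A B v a u : height Pi B = 0 -> v = A - B -> vproj Pi v = a *: u ->
    v = a *: u + be A *: n.
  by move=> hB vE <-; rewrite /vproj -/n {3}vE dotn hB subr0 subrK.
have G1_C2 : G1_spline p q -> C2.
  move=> [_ g1]; apply: vproj_lerp => // x x01.
  have := not_free3_dot (g1 x x01); rewrite pxi peta qeta => /eqP.
  (* The V part of the third vector drops out of the determinant, and the remaining factor [m x] can
     be cancelled. *)
  have -> : dot (cross (2 *: lerp u0 u1 x) (2 *: lerp v00 v10 x))
       (2 *: (lerp v00 v10 x - (2 * m x) *: n)) =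
     (- 16 * m x) * dot n (cross (lerp u0 u1 x) (lerp v00 v10 x)).
    by rewrite !coordE; ring.
  by rewrite !mulf_eq0 oppr_eq0 pnatr_eq0 (negPf (mN0 x x01)) => /eqP.
have C2_G2 : C2 -> G2_spline p q.
  move=> [a [/(vprojE _ _ _ _ _ h002 v00E) e0
            /(vprojE _ _ _ _ _ h101 v10E) e1]].
  split=> //.
  (* Reflection changes the second eta-derivative by 2 (4 b0 - 2 c) n, and the mixed term
     contributes -8 a (b1 - b0) n; [s2] balances them against 2 m n. The tangential terms cancel by
     the choice of [t1] and [t2]. *)
  pose s2 x := (4 * b0 - 2 * c + 4 * a * (b1 - b0)) / m x.
  exists (fun=> - 1), (fun=> 2 * a), s2, (fun x => - a * s2 x) => x x01.
  have L : lerp v00 v10 x = a *: lerp u0 u1 x + m x *: n.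
    by rewrite e0 e1 -/b0 -/b1 /lerp /m; apply: row3P; rewrite !coordE; ring.
  split.
    by rewrite qeta peta pxi L; apply: row3P; rewrite !coordE; ring.
  rewrite peta pxi /q /p !d_eta_eta_bezier2 d_xi_eta_bezier2 d_xi_xi_bezier2.
  rewrite Q002 !reflE -/b0 -/c L -v00E -v10E e0 e1 -/b0 -/b1.
  have -> : (P 2 0 0)%N - 2 *: (P 1 0 1)%N + (P 0 0 2)%N = u1 - u0.
    by rewrite u0E u1E; apply: row3P; rewrite !coordE; ring.
  have s2m : s2 x * m x = 4 * b0 - 2 * c + 4 * a * (b1 - b0).
    by rewrite divfK ?mN0.
  rewrite -[RHS]addrA.
  have -> : s2 x *: (2 *: (a *: lerp u0 u1 x + m x *: n))
      + (- a * s2 x) *: (2 *: lerp u0 u1 x) =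
    (2 * (4 * b0 - 2 * c + 4 * a * (b1 - b0))) *: n.
    by rewrite -s2m; apply: row3P; rewrite !coordE; ring.
  by apply: row3P; rewrite !coordE; ring.
have G2_G1 : G2_spline p q -> G1_spline p q.
  move=> [_ [s1 [t1 [s2 [t2 g2]]]]]; split=> // x x01.
  have [e _] := g2 x x01.
  (* Rotating the triple puts the eta-derivative of q first; the first-order equation places it in
     the span of the other two. *)
  rewrite -(perm_free (permEl (perm_rot 2 _))).
  rewrite /rot /= free_cons negb_and negbK.
  by apply/orP; left; apply/span2P; exists (t1 x), (s1 x); rewrite e [RHS]addrC.
have u01_n : cross n (cross u0 u1) = 0.
  by rewrite cross_cross nu0 nu1 !scale0r subrr.
have pxiN0 x : d_xi p x 0 != 0.
  by rewrite pxi scaler_eq0 pnatr_eq0 /= lerp_neq0.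
have C2_normal : C2 -> forall x, 0 <= x <= 1 ->
    normal_vector (tangent_plane p x) (cross (d_xi p x 0) (cross u0 u1)).
  move=> [a [/(vprojE _ _ _ _ _ h002 v00E) e0
            /(vprojE _ _ _ _ _ h101 v10E) e1]] x x01.
  have L : d_eta p x 0 = a *: d_xi p x 0 + (2 * m x) *: n.
    rewrite peta pxi e0 e1 -/b0 -/b1 /lerp /m.
    by apply: row3P; rewrite !coordE; ring.
  have npxi : dot n (d_xi p x 0) = 0.
    rewrite pxi; have -> : dot n (2 *: lerp u0 u1 x) =
      2 * ((1 - x) * dot n u0 + x * dot n u1) by rewrite /lerp !coordE; ring.
    by rewrite nu0 nu1 !mulr0 addr0 mulr0.
  by rewrite /tangent_plane L; apply: normal_vector_cross;
    rewrite ?mulf_neq0 ?pnatr_eq0 ?mN0 ?normal_neq0.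
have normal_C2 : (forall x, 0 <= x <= 1 ->
    normal_vector (tangent_plane p x) (cross (d_xi p x 0) (cross u0 u1))) -> C2.
  move=> h; apply: vproj_lerp => // x x01; have [_ _ hN] := h x x01.
  have : d_eta p x 0 \in tangent_plane p x.
    by apply/span2P; exists 0, 1; rewrite scale0r add0r scale1r.
  move=> /hN; rewrite pxi peta => e.
  have n01 := cross_orthogonal nu0 nu1.
  (* Up to the factor n.n, u0 x u1 equals (n.(u0 x u1)) n, so orthogonality of the eta-derivative to
     the proposed normal becomes this product. Its first factor is nonzero because u0 x u1 is. *)
  have : dot n (cross u0 u1)
      * dot n (cross (lerp u0 u1 x) (lerp v00 v10 x)) = 0.
    have -> : dot n (cross u0 u1)
        * dot n (cross (lerp u0 u1 x) (lerp v00 v10 x)) =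
      - dot (cross (lerp u0 u1 x) (dot n (cross u0 u1) *: n)) (lerp v00 v10 x).
      by rewrite !coordE; ring.
    rewrite -n01; have -> : dot (cross (lerp u0 u1 x) (dot n n *: cross u0 u1))
        (lerp v00 v10 x) = dot n n / 4 *
      dot (cross (2 *: lerp u0 u1 x) (cross u0 u1)) (2 *: lerp v00 v10 x).
      by rewrite !coordE; field.
    by rewrite e mulr0 oppr0.
  move=> /eqP; rewrite mulf_eq0 => /orP[/eqP n0|/eqP //].
  move: n01; rewrite n0 scale0r => /eqP.
  by rewrite scaler_eq0 (negPf N0) (negPf u01).
(* In the cycle 1, 2, 3, 4, 1 the last two implications are composed through condition 2. *)
tfae=> //.
- by move=> /G2_G1/G1_C2/C2_normal.
- by move=> /normal_C2/C2_G2/G2_G1.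
Qed.
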